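(* Consider the mixed-integer linear program (MILP) $$\min_{z}\ c^\top z\quad\text{subject to}\quad a_i^\top z\le b_i,\ i=1,\dots,n,\quad z\in\mathbb{Z}^{d_Z}\times\mathbb{R}^{d_R},$$ with $d=d_Z+d_R$, $a_i,c\in\mathbb{R}^d$, $b_i\in\mathbb{R}$. Let $P=\bigcap_{i=1}^n\{z\in\mathbb{R}^d: a_i^\top z\le b_i\}$ and $P_I=P\cap(\mathbb{Z}^{d_Z}\times\mathbb{R}^{d_R})$, and let $\epsilon>0$. Assume that $P$ is bounded, that $\mathrm{conv}(P_I)$ is nonempty, and that $P\subseteq H_M=\{z\in\mathbb{R}^d:-M\le z_\ell\le M,\ \ell=1,\dots,d\}$, where $M>0$ satisfies $$M\ \ge\ \max\Big(-\min_{z\in P}c^\top z/\epsilon,\ \Big\lceil\max_{z\in P}c^\top z/\epsilon\Big\rceil\Big).$$ Suppose that $N=n$ agents communicate according to a jointly strongly connected time-varying digraph $\mathcal{G}_c(t)$, $t\ge0$, and run the $\epsilon$-DiCUT-MILP distributed algorithm (defined in the context), producing $(\rho_I^{[i]}(t),z^{[i]}(t))$. Then, in a finite number of communication rounds, the sequences $\{z^{[i]}(t)\}_{t\ge0}$, $i\in\{1,\dots,N\}$, converge to an $\epsilon$-suboptimal solution of the MILP; that is, there are a finite $T$ and an $\epsilon$-suboptimal solution $z^\epsilon$ of the MILP such that $z^{[i]}(t)=z^\epsilon$ for all $t\ge T$ and all $i$.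
   Context: $\epsilon$-suboptimality. A point $z^\epsilon$ is an $\epsilon$-suboptimal solution of the MILP if it is feasible for it and $c^\top z^\epsilon-c^\top z^\star\le\epsilon$, where $z^\star$ is an optimal solution of the MILP. Lexicographic order and lex-optimality. For vectors $v,w$ of equal dimension, $v>_{lex}w$ if there is $\ell$ with $v_\ell>w_\ell$ and $v_m=w_m$ for all $m<\ell$. The lex-optimal solution of a linear program (LP) is its lexicographically minimal optimal solution. For an LP in $\mathbb{R}^{D}$ whose constraint set is a finite intersection of half-spaces, a basis (for the lex-optimal solution $w^{LP}$) is the intersection of a minimal number of these half-spaces such that the lex-optimal solution over the intersection is still $w^{LP}$; it consists of exactly $D$ half-spaces, and is written $B=\{w:A_Bw\le b_B\}$ with $A_B\in\mathbb{R}^{D\times D}$ invertible. $\mathrm{LPlexsolv}(H,f)$ returns the lex-optimal solution of $\min\{f^\top w:w\in H\}$ together with a basis identifying it. MIG cut. Let the integer-constrained variables be the first $D_Z$ components of $w\in\mathbb{R}^D$, and let $(w^{LP},B^{LP})$ be a lex-optimal solution and basis with $w^{LP}_\ell\notin\mathbb{Z}$, $\ell\le D_Z$. Let $r^m$ be the $m$-th column of $-A_B^{-1}$, $m=1,\dots,D$, and $e_\ell$ the $\ell$-th canonical vector. Put $\lambda_m=\frac{\lfloor w^{LP}_\ell\rfloor-w^{LP}_\ell}{e_\ell^\top r^m}$ if $e_\ell^\top r^m<0$, $\lambda_m=\frac{\lfloor w^{LP}_\ell\rfloor+1-w^{LP}_\ell}{e_\ell^\top r^m}$ if $e_\ell^\top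 r^m>0$, $\lambda_m=\infty$ if $e_\ell^\top r^m=0$; and $\Lambda_m=1/\lambda_m$ ($\Lambda_m=0$ if $\lambda_m=\infty$). The intersection cut to the disjunction $\{w_\ell\le\lfloor w^{LP}_\ell\rfloor\}\cup\{w_\ell\ge\lfloor w^{LP}_\ell\rfloor+1\}$ and basis $B^{LP}$ is $\{w:\Lambda^\top A_Bw\le\Lambda^\top b_B-1\}$. $\mathrm{MIGoracle}(w,B)$ returns this cut for $\ell=\min\{k\le D_Z:w_k\notin\mathbb{Z}\}$; if $w_1,\dots,w_{D_Z}$ are all integers it returns no constraint (i.e. $\mathbb{R}^D$). Network. Agents are $V=\{1,\dots,N\}$; at time $t\in\mathbb{N}$ the communication digraph is $\mathcal{G}_c(t)=(V,E(t))$, with $(i,j)\in E(t)$ iff $i$ can send information to $j$ at time $t$; $\mathcal{N}_i(t)=\{j:(j,i)\in E(t)\}$. The time-varying digraph is jointly strongly connected if for every $t\in\mathbb{N}$ the digraph $\bigcup_{\tau=t}^\infty\mathcal{G}_c(\tau)$ is strongly connected. $\epsilon$-DiCUT-MILP. The decision variable is $w=(\rho_I,z)\in\mathbb{R}^{d+1}$ ($D=d+1$), the integer-constrained variables are $\rho_I$ and the first $d_Z$ components of $z$ ($D_Z=d_Z+1$), and the cost vector is $e_1=[1,0,\dots,0]^\top$ (i.e. the cost is $\rho_I$). Let $H_M^\epsilon=\{(\rho_I,z)\in\mathbb{R}^{d+1}:-M\le\rho_I\le M,\ -M\le z_\ell\le M,\ \ell=1,\dots,d\}$. Agent $i$ knows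 $h^{[i]}=\{a_i^\top z\le b_i\}\cap\{c^\top z\le\epsilon\rho_I\}\cap H_M^\epsilon$. Initialization: $((\rho_I^{[i]}(0),z^{[i]}(0)),B^{[i]}(0))=\mathrm{LPlexsolv}(h^{[i]},e_1)$. At each $t\ge0$ every agent $i$ sets $h_{mig}(t)=\mathrm{MIGoracle}((\rho_I^{[i]}(t),z^{[i]}(t)),B^{[i]}(t))$, $h_c(t)=\{(\rho_I,z):\rho_I\ge\lceil\rho_I^{[i]}(t)\rceil\}$, $$H_{tmp}(t)=\Big(\bigcap_{j\in\mathcal{N}_i(t)}B^{[j]}(t)\Big)\cap B^{[i]}(t)\cap h^{[i]}\cap h_{mig}(t)\cap h_c(t),$$ and $((\rho_I^{[i]}(t+1),z^{[i]}(t+1)),B^{[i]}(t+1))=\mathrm{LPlexsolv}(H_{tmp}(t),e_1)$. *)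

(* Defs.v *)
From HB Require Import structures.
From mathcomp Require Import all_boot all_order all_algebra.
From mathcomp Require Import all_classical all_reals all_analysis.

Set Implicit Arguments.
Unset Strict Implicit.
Unset Printing Implicit Defensive.

Import Order.TTheory GRing.Theory Num.Theory.
Import numFieldNormedType.Exports.
Local Open Scope classical_set_scope.
Local Open Scope ring_scope.

Section LinearPrograms.
Context {R : realType}.

Definition dotv D (u v : 'cV[R]_D) : R := (u^T *m v) 0 0.

(* [(a, b)] stands for the half-space { w | a^T w <= b }. *)
Definition halfspace D : Type := ('cV[R]_D * R)%type.

Definition polyhedron D (H : seq (halfspace D)) : set 'cV[R]_D :=
  [set w | forall h, h \in H -> dotv h.1 w <= h.2].

Definition lex_gt D (v w : 'cV[R]_D) : Prop :=
  exists2 l : 'I_D, w l 0 < v l 0 & forall m : 'I_D, (m < l)%N -> v m 0 = w m 0.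

(* [w] minimizes f^T w over [X]. *)
Definition is_opt D (X : set 'cV[R]_D) (f w : 'cV[R]_D) : Prop :=
  X w /\ forall v, X v -> dotv f w <= dotv f v.

Definition is_lexopt D (X : set 'cV[R]_D) (f w : 'cV[R]_D) : Prop :=
  is_opt X f w /\ forall v, is_opt X f v -> v <> w -> lex_gt v w.

(* [(A_B, b_B)] stands for { w | A_B w <= b_B }. *)
Definition lp_basis D : Type := ('M[R]_D * 'cV[R]_D)%type.

Definition basis_rows D (B : lp_basis D) : seq (halfspace D) :=
  [seq ((row m B.1)^T, B.2 m 0) | m : 'I_D].

(* [B] consists of a least possible number of half-spaces of [H] over whose
   intersection the lex-optimal solution is still [w]. *)
Definition is_lp_basis D (H : seq (halfspace D)) (f w : 'cV[R]_D) (B : lp_basis D)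
    : Prop :=
  [/\ {subset basis_rows B <= H},
      is_lexopt (polyhedron (basis_rows B)) f w,
      forall S : seq (halfspace D), {subset S <= H} ->
        is_lexopt (polyhedron S) f w -> (size (basis_rows B) <= size S)%N
    & B.1 \in unitmx].

(* [out] is a possible output of LPlexsolv(H, f).  A lex-optimal solution may
   have several bases, any of which may be returned.  Nothing is assumed of the
   output when the LP has no lex-optimal solution, so that solvability of the
   LPs met by the algorithm is not built into the definition of a run. *)
Definition LPlexsolv D (H : seq (halfspace D)) (f : 'cV[R]_D)
    (out : 'cV[R]_D * lp_basis D) : Prop :=
  forall v, is_lexopt (polyhedron H) f v ->
    out.1 = v /\ is_lp_basis H f v out.2.

End LinearPrograms.

Section MIGCut.
Context {R : realType}.
Variable D : nat.
Implicit Types (w : 'cV[R]_D) (B : @lp_basis R D) (l m : 'I_D).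

(* e_l^T r^m, with r^m the m-th column of - A_B^-1 *)
Definition ray_entry B l m : R := (- invmx B.1) l m.

(* the coefficient 1 / lambda_m, which is 0 when lambda_m is infinite *)
Definition mig_coef w B l m : R :=
  let r := ray_entry B l m in
  let fl : R := (Num.floor (w l 0))%:~R in
  if r < 0 then ((fl - w l 0) / r)^-1
  else if 0 < r then ((fl + 1 - w l 0) / r)^-1
  else 0.

Definition mig_cut w B l : @halfspace R D :=
  let L : 'cV[R]_D := \col_m mig_coef w B l m in
  ((L^T *m B.1)^T, dotv L B.2 - 1).

(* The integer-constrained variables are the first [DZ] ones; the result is the
   list of constraints returned, which has at most one element. *)
Definition MIGoracle (DZ : nat) w B : seq (@halfspace R D) :=
  if [pick l : 'I_D | [&& (l < DZ)%N, w l 0 \isn't a Num.int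
        & [forall k : 'I_D, (k < l)%N ==> (w k 0 \is a Num.int)]]]
  is Some l then [:: mig_cut w B l] else [::].

End MIGCut.

Section Network.
Variable V : finType.

(* There is an edge from [u] to [v] at time [t] iff [E t u v]. *)
Definition jointly_strongly_connected (E : nat -> rel V) : Prop :=
  forall (t : nat) (i j : V),
    connect (fun u v => `[< exists2 tau, (t <= tau)%N & E tau u v >]) i j.

Definition in_neighbors (E : nat -> rel V) (t : nat) (i : V) : {set V} :=
  [set j | E t j i].

End Network.

Section MILP.
Context {R : realType}.
Variables (n dZ dR : nat).
Variables (a : 'I_n -> 'cV[R]_(dZ + dR)) (b : 'I_n -> R).
Variables (c : 'cV[R]_(dZ + dR)) (eps : R).

Definition milp_P : set 'cV[R]_(dZ + dR) :=
  [set z | forall i, dotv (a i) z <= b i].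

Definition milp_PI : set 'cV[R]_(dZ + dR) :=
  milp_P `&` [set z | forall k : 'I_dZ, z (lshift dR k) 0 \is a Num.int].

Definition eps_suboptimal (z : 'cV[R]_(dZ + dR)) : Prop :=
  milp_PI z /\ exists2 zs, is_opt milp_PI c zs & dotv c z - dotv c zs <= eps.

End MILP.

Section Algorithm.
Context {R : realType}.
Variables (n dZ dR : nat).
Variables (a : 'I_n -> 'cV[R]_(dZ + dR)) (b : 'I_n -> R).
Variables (c : 'cV[R]_(dZ + dR)) (eps M : R) (E : nat -> rel 'I_n).

Local Notation d := (dZ + dR)%N.

(* the half-spaces - M <= w_k <= M *)
Definition box D : seq (@halfspace R D) :=
  [seq (delta_mx k 0, M) | k : 'I_D] ++ [seq (- delta_mx k 0, M) | k : 'I_D].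

(* The decision variable (rho_I, z) is a column vector of type 'cV_(1 + d). *)
Definition e1 : 'cV[R]_(1 + d) := col_mx 1%:M 0.

Definition rho_of (w : 'cV[R]_(1 + d)) : R := usubmx w 0 0.

Definition z_of (w : 'cV[R]_(1 + d)) : 'cV[R]_d := dsubmx w.

(* a_i^T z <= b_i, c^T z - eps rho_I <= 0, and the box *)
Definition agent_constraints (i : 'I_n) : seq (@halfspace R (1 + d)) :=
  [:: (col_mx 0 (a i), b i); (col_mx (- eps)%:M c, 0)] ++ box (1 + d).

(* rho_I >= ceil (rho_I of w), written with <= *)
Definition cost_cut (w : 'cV[R]_(1 + d)) : @halfspace R (1 + d) :=
  (- e1, - (Num.ceil (rho_of w))%:~R).

Definition state : Type := ('cV[R]_(1 + d) * @lp_basis R (1 + d))%type.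

Definition Htmp (x : 'I_n -> nat -> state) (i : 'I_n) (t : nat)
    : seq (@halfspace R (1 + d)) :=
  flatten [seq basis_rows (x j t).2 | j in in_neighbors E t i]
  ++ basis_rows (x i t).2
  ++ agent_constraints i
  ++ MIGoracle (1 + dZ) (x i t).1 (x i t).2
  ++ [:: cost_cut (x i t).1].

(* [x] is a run of the epsilon-DiCUT-MILP algorithm. *)
Definition dicut_run (x : 'I_n -> nat -> state) : Prop :=
  (forall i, LPlexsolv (agent_constraints i) e1 (x i 0%N)) /\
  (forall i t, LPlexsolv (Htmp x i t) e1 (x i t.+1)).

End Algorithm.

Section Extrema.
Context {R : realType}.

Definition is_min (S : set R) (m : R) : Prop := S m /\ lbound S m.
Definition is_max (S : set R) (m : R) : Prop := S m /\ ubound S m.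

Definition convex_hull D (A : set 'cV[R]_D) : set 'cV[R]_D :=
  smallest (@convex_set R 'cV[R]_D) A.

End Extrema.

(* Main.v *)
Require Import Defs.
From HB Require Import structures.
From mathcomp Require Import all_boot all_order all_algebra.
From mathcomp Require Import all_classical all_reals all_analysis.
From mathcomp Require Import ring lra zify.

Set Implicit Arguments.
Unset Strict Implicit.
Unset Printing Implicit Defensive.

Import Order.TTheory GRing.Theory Num.Theory.
Import numFieldNormedType.Exports.
Local Open Scope classical_set_scope.
Local Open Scope ring_scope.

(** The cost is the first coordinate, so a lex-optimal point is a lexicographic
    minimum.  Let X be the set of points (rho, z) with rho integer and z feasible
    for the MILP.  All cuts are valid for X, so every LP is feasible and bounded,
    and each agent's iterates increase lexicographically since H_tmp contains the
    agent's own basis.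

    Integer coordinates stabilise one after the other: the edges of the basis
    cone are lexicographically positive, so a point of the cone that satisfies
    the MIG cut at coordinate l and keeps the coordinates before l uses only
    edges along which coordinate l does not decrease; the cut then pushes this
    coordinate past the next integer.  After that no new half-space is created,
    the iterates are vertices of a finite arrangement, and they become constant.
    An edge from j to i forces the value of j to be at most that of i, so joint
    strong connectivity gives consensus.  The common point (rho, z) is
    lexicographically below (ceil (c^T zs / eps), zs) in X, for an optimal
    zs, whence c^T z <= eps rho <= c^T zs + eps. *)

(** * Lexicographic order and lexicographic minima of compact sets *)

Section LexOrder.
Context {R : realType} {D : nat}.
Implicit Types u v w : 'cV[R]_D.

Definition lex_le v w : Prop := v = w \/ lex_gt w v.

Lemma lex_gt_irrefl v : ~ lex_gt v v.
Proof. by case=> l; rewrite ltxx. Qed.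

Lemma lex_gt_trans v u w : lex_gt u v -> lex_gt v w -> lex_gt u w.
Proof.
move=> [l lt_l eq_l] [k lt_k eq_k].
have [lt_lk|lt_kl|/val_inj eq_lk] := ltngtP l k.
- exists l; first by rewrite -eq_k.
  by move=> m lt_ml; rewrite eq_l // eq_k // (ltn_trans lt_ml).
- exists k; first by rewrite eq_l.
  by move=> m lt_mk; rewrite eq_l ?eq_k // (ltn_trans lt_mk).
- subst k; exists l; first exact: lt_trans lt_k lt_l.
  by move=> m lt_ml; rewrite eq_l ?eq_k.
Qed.

Lemma lex_lexx v : lex_le v v. Proof. by left. Qed.

Lemma lex_le_trans v u w : lex_le u v -> lex_le v w -> lex_le u w.
Proof.
move=> [->//|gt_vu] [<-|gt_wv]; first by right.
by right; apply: lex_gt_trans gt_wv gt_vu.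
Qed.

Lemma lex_le_anti u v : lex_le u v -> lex_le v u -> u = v.
Proof.
move=> [//|gt_vu] [//|gt_uv].
by case: (lex_gt_irrefl (lex_gt_trans gt_vu gt_uv)).
Qed.

(** Turns a lexicographic comparison into a scalar one at the first coordinate not yet known to
    agree. At the leading coordinate the agreement premise is vacuous, which gives [lex_le_rho]. *)
Lemma lex_le_coord u v (l : 'I_D) :
  lex_le u v -> (forall m : 'I_D, (m < l)%N -> u m 0 = v m 0) ->
  u l 0 <= v l 0.
Proof.
move=> [->//|[k lt_k eq_k]] eq_l.
have [lt_lk|lt_kl|/val_inj eq_lk] := ltngtP l k.
- by rewrite eq_k.
- by move: lt_k; rewrite eq_l ?ltxx.
- by subst k; apply: ltW.
Qed.

(* D stages: stage k keeps the points of the previous stage whose k-th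
   coordinate is least. *)
Lemma compact_lexmin (K : set 'cV[R]_D) :
  K !=set0 -> compact [set v : 'rV[R]_D | K v^T] ->
  exists2 w, K w & forall v, K v -> lex_le w v.
Proof.
move=> [w0 Kw0] cK.
suff: forall k, (k <= D)%N -> exists L : set 'rV[R]_D,
  [/\ L !=set0, compact L, L `<=` [set v | K v^T],
    (forall (v w : 'rV[R]_D) (l : 'I_D), L v -> L w -> (l < k)%N -> v 0 l = w 0 l) &
    (forall v w : 'rV[R]_D, K v^T -> ~ L v -> L w -> lex_gt v^T w^T)].
  move=> /(_ D (leqnn D)) [L [[w Lw] _ LK Leq Lgt]].
  exists w^T; first exact: LK.
  move=> v Kv; have [Lv|nLv] := pselect (L v^T).
    left; apply/matrixP => l j; rewrite ord1 mxE (Leq w v^T l) ?ltn_ord //.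
    by rewrite mxE.
  by right; rewrite -(trmxK v); apply: Lgt; rewrite ?trmxK.
elim=> [_|k IHk lt_kD].
  exists [set v | K v^T]; split=> //.
  by exists w0^T; rewrite /= trmxK.
have [L [L0 cL LK Leq Lgt]] := IHk (ltnW lt_kD).
pose o := Ordinal lt_kD.
have cont : {within L, continuous (fun v : 'rV[R]_D => v 0 o)}.
  by apply: continuous_subspaceT => v; apply: coord_continuous.
have [m /set_mem Lm minm] := compact_EVT_min L0 cL cont.
exists (L `&` [set v : 'rV[R]_D | v 0 o <= m 0 o]); split.
- by exists m; split=> /=.
- apply: compact_closedI => //.
  apply: (@preimage_closed _ _ (fun v : 'rV[R]_D => v 0 o) [set y | y <= m 0 o]).
    by move=> v _; apply: coord_continuous.
  exact: closed_le.
- by move=> v [/LK].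
- move=> v w l [Lv /= vm] [Lw /= wm]; rewrite ltnS leq_eqVlt => /orP[/eqP lk|].
    have -> : l = o by apply: val_inj.
    apply/eqP; rewrite eq_le (le_trans vm) ?(le_trans wm) //; apply: minm;
      exact: mem_set.
  exact: Leq.
(* A point dropped at this stage agrees with [w] before [k] and is larger at [k]; a point dropped
   earlier is settled by the induction hypothesis. *)
- move=> v w Kv nv [Lw /= wm].
  have [Lv|nLv] := pselect (L v); last exact: Lgt.
  exists o; first by rewrite !mxE (le_lt_trans wm) // ltNge; apply/negP => ?; apply: nv.
  by move=> l lk; rewrite !mxE; apply: Leq.
Qed.

End LexOrder.

(** * Eventually constant sequences *)

Lemma nonincreasing_nat_stable (f : nat -> nat) (t0 : nat) :
  (forall t, (t0 <= t)%N -> (f t.+1 <= f t)%N) ->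
  exists2 T, (t0 <= T)%N & forall t, (T <= t)%N -> f t = f T.
Proof.
move=> f_dec.
pose P k := `[< exists2 t, (t0 <= t)%N & f t = k >].
have exP : exists k, P k by exists (f t0); apply/asboolP; exists t0.
case: (ex_minnP exP) => k /asboolP[T leT fT] mink.
exists T => // t leTt; apply/eqP; rewrite eqn_leq; apply/andP; split.
  elim: t leTt => [|t IHt]; first by rewrite leqn0 => /eqP ->.
  rewrite leq_eqVlt => /orP[/eqP->//|]; rewrite ltnS => leTt.
  by apply: leq_trans (IHt leTt); apply: f_dec; apply: leq_trans leTt.
by rewrite fT; apply: mink; apply/asboolP; exists t => //; apply: leq_trans leTt.
Qed.

(** The floors form a nondecreasing integer sequence bounded by the floor of [M], hence freeze.
    After that a non-integer value is impossible, since it would raise the next floor. *)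
Lemma floor_jump_stable {R : realType} (f : nat -> R) (M : R) (t0 : nat) :
  (forall t, (t0 <= t)%N -> f t <= f t.+1) ->
  (forall t, (t0 <= t)%N -> f t <= M) ->
  (forall t, (t0 <= t)%N -> f t \isn't a Num.int ->
     (Num.floor (f t))%:~R + 1 <= f t.+1) ->
  exists2 T, (t0 <= T)%N &
    forall t, (T <= t)%N -> f t = f T /\ f t \is a Num.int.
Proof.
move=> f_inc f_le f_jump.
pose g t := `|Num.floor M - Num.floor (f t)|%N.
have floor_le t : (t0 <= t)%N -> Num.floor (f t) <= Num.floor M.
  by move=> ?; apply: le_floor; apply: f_le.
have floor_inc t : (t0 <= t)%N -> Num.floor (f t) <= Num.floor (f t.+1).
  by move=> ?; apply: le_floor; apply: f_inc.
have g_dec t : (t0 <= t)%N -> (g t.+1 <= g t)%N.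
  move=> let0; have := floor_inc t let0; have := floor_le t let0.
  have := floor_le t.+1 (leq_trans let0 (leqnSn t)); rewrite /g; lia.
have [T leT gT] := nonincreasing_nat_stable g_dec.
have flT t : (T <= t)%N -> Num.floor (f t) = Num.floor (f T).
  move=> leTt; have := gT t leTt.
  have := floor_le t (leq_trans leT leTt); have := floor_le T leT; rewrite /g; lia.
have intT t : (T <= t)%N -> f t \is a Num.int.
  move=> leTt; apply/negPn/negP => nint.
  have := f_jump t (leq_trans leT leTt) nint.
  rewrite -[1]/(1%:~R) -intrD -floor_ge_int (flT t leTt) (flT t.+1 (leqW leTt)); lia.
exists T => // t leTt; split; last exact: intT.
by rewrite -(floorK (intT t leTt)) flT // floorK // intT.
Qed.

Lemma finType_common_bound (I : finType) (P : I -> nat -> Prop) :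
  (forall i, exists T, forall t, (T <= t)%N -> P i t) ->
  exists T, forall i t, (T <= t)%N -> P i t.
Proof.
move=> exT; have [T PT] := choice exT.
exists (\max_i T i)%N => i t leT; apply: PT; apply: leq_trans leT.
exact: leq_bigmax.
Qed.

Section LexSequences.
Context {R : realType} {D : nat}.

(** Induction on the number of frozen coordinates: once those before [l] are constant, lexicographic
    growth makes coordinate [l] nondecreasing, and [floor_jump_stable] freezes it at an integer. *)
Lemma integer_coords_stable (u : nat -> 'cV[R]_D) (M : R) (DZ : nat) :
  (forall t, lex_le (u t) (u t.+1)) ->
  (forall t l, u t l 0 <= M) ->
  (forall t (l : 'I_D), (l < DZ)%N -> u t l 0 \isn't a Num.int ->
     (forall k : 'I_D, (k < l)%N ->
        u t k 0 \is a Num.int /\ u t.+1 k 0 = u t k 0) ->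
     (Num.floor (u t l 0))%:~R + 1 <= u t.+1 l 0) ->
  exists T, forall t, (T <= t)%N -> forall l : 'I_D, (l < DZ)%N ->
    u t l 0 = u T l 0 /\ u t l 0 \is a Num.int.
Proof.
move=> u_inc u_le u_jump.
suff: forall k, (k <= DZ)%N -> exists T, forall t, (T <= t)%N ->
  forall l : 'I_D, (l < k)%N -> u t l 0 = u T l 0 /\ u t l 0 \is a Num.int.
  exact.
elim=> [_|k IHk lt_k]; first by exists 0%N.
have [T HT] := IHk (ltnW lt_k).
(* [DZ] is not assumed to be at most [D]; beyond [D] there is no coordinate left to freeze. *)
have [lt_kD|le_Dk] := ltnP k D; last first.
  by exists T => t leTt l _; apply: HT => //; apply: leq_trans le_Dk.
pose o := Ordinal lt_kD.
have eqT t : (T <= t)%N -> forall l : 'I_D, (l < o)%N -> u t.+1 l 0 = u t l 0.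
  by move=> leTt l lo; rewrite (HT t _ l lo).1 // (HT t.+1 (leqW leTt) l lo).1.
have [||t leTt nint|T' leT' HT'] := @floor_jump_stable _ (fun t => u t o 0) M T.
- by move=> t leTt; apply: lex_le_coord => // l lo; rewrite eqT.
- by move=> t _; apply: u_le.
- apply: u_jump => // l lo; split; last exact: eqT.
  exact: (HT t leTt l lo).2.
- exists T' => t leTt l; rewrite ltnS leq_eqVlt => /orP[/eqP lk|lk].
    have -> : l = o by apply: val_inj.
    exact: HT'.
  have [-> ->] := HT t (leq_trans leT' leTt) l lk.
  by have [-> _] := HT T' leT' l lk.
Qed.

(** The set of indices whose value lies lexicographically above [u t] can only shrink, so it
    stabilises. The index of [u t] itself then survives to the next time, which bounds [u t.+1] by
    [u t]. *)
Lemma finite_range_stable (I : finType) (g : I -> 'cV[R]_D)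
    (u : nat -> 'cV[R]_D) (t0 : nat) :
  (forall t, (t0 <= t)%N -> exists i, u t = g i) ->
  (forall t, (t0 <= t)%N -> lex_le (u t) (u t.+1)) ->
  exists2 T, (t0 <= T)%N & forall t, (T <= t)%N -> u t = u T.
Proof.
move=> u_in u_inc.
pose A t : {set I} := finset.finset (fun i => `[< lex_le (u t) (g i) >]).
have A_dec t : (t0 <= t)%N -> A t.+1 \subset A t.
  move=> let0; apply/fintype.subsetP => i; rewrite !finset.inE => /asboolP le_i.
  by apply/asboolP; exact: lex_le_trans (u_inc t let0) le_i.
have [T leT cardT] := @nonincreasing_nat_stable (fun t => #|A t|) t0
  (fun t ht => subset_leq_card (A_dec t ht)).
exists T => //; elim=> [|t IHt]; first by rewrite leqn0 => /eqP ->.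
rewrite leq_eqVlt => /orP[/eqP->//|]; rewrite ltnS => leTt.
rewrite -IHt //; have let0 := leq_trans leT leTt.
have eqA : A t.+1 = A t.
  by apply/eqP; rewrite eqEcard A_dec //= cardT // cardT // leqW.
have [i ui] := u_in t let0.
have : i \in A t by rewrite finset.inE; apply/asboolP; left.
rewrite -eqA finset.inE -ui => /asboolP le_t; apply: lex_le_anti => //; exact: u_inc.
Qed.

End LexSequences.

(** * Basis cones, their edges, and the MIG cut *)

Section BasisCones.
Context {R : realType} {D : nat}.
Implicit Types (w v : 'cV[R]_D) (B : @lp_basis R D) (l m : 'I_D).

Lemma dotvE (u v : 'cV[R]_D) : dotv u v = \sum_k u k 0 * v k 0.
Proof. by rewrite /dotv mxE; apply: eq_bigr => k _; rewrite mxE. Qed.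

Lemma polyhedron_subset (H H' : seq (@halfspace R D)) :
  {subset H <= H'} -> polyhedron H' `<=` polyhedron H.
Proof. by move=> sHH' w Hw h /sHH'/Hw. Qed.

Lemma polyhedron_cat (H H' : seq (@halfspace R D)) :
  polyhedron (H ++ H') = polyhedron H `&` polyhedron H'.
Proof.
apply/seteqP; split=> [w Hw|w [Hw Hw'] h].
  by split; apply: polyhedron_subset Hw => h hH; rewrite mem_cat hH ?orbT.
by rewrite mem_cat => /orP[/Hw|/Hw'].
Qed.

Lemma polyhedron_seq1 (h : @halfspace R D) :
  polyhedron [:: h] = [set w | dotv h.1 w <= h.2].
Proof.
apply/seteqP; split=> w /= Hw; first by apply: Hw; rewrite mem_head.
by move=> k; rewrite mem_seq1 => /eqP ->.
Qed.

Lemma basis_rowsP B w :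
  polyhedron (basis_rows B) w <-> forall m, (B.1 *m w) m 0 <= B.2 m 0.
Proof.
have rowE m : dotv (row m B.1)^T w = (B.1 *m w) m 0.
  by rewrite /dotv trmxK -row_mul mxE.
split=> [Bw m|Bw h /mapP[m _ ->] /=]; last by rewrite rowE.
rewrite -rowE; apply: (Bw ((row m B.1)^T, B.2 m 0)).
by apply/mapP; exists m; rewrite ?mem_enum.
Qed.

(** By [is_lexopt_e1] this is lex-optimality over the basis cone for the cost [e1], stated without a
    cost vector. *)
Definition lexmin_of B w :=
  polyhedron (basis_rows B) w /\
  forall v, polyhedron (basis_rows B) v -> lex_le w v.

(* If row m were slack, w could be moved both ways along a line of the cone. *)
Lemma lexmin_vertex B w : B.1 \in unitmx -> lexmin_of B w -> B.1 *m w = B.2.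
Proof.
move=> unitB [/basis_rowsP Bw minw].
pose s := B.2 - B.1 *m w.
have sE m : s m 0 = B.2 m 0 - (B.1 *m w) m 0 by rewrite /s mxE [X in _ + X]mxE.
have s_ge0 m : 0 <= s m 0 by rewrite sE subr_ge0.
have [u Bu] : exists u : 'cV[R]_D, B.1 *m u = s.
  by exists (invmx B.1 *m s); rewrite mulmxA mulmxV // mul1mx.
have le1 : lex_le w (w + u).
  apply: minw; apply/basis_rowsP => m.
  by rewrite mulmxDr Bu addrC subrK.
have le2 : lex_le w (w - u).
  apply: minw; apply/basis_rowsP => m.
  have -> : (B.1 *m (w - u)) m 0 = (B.1 *m w) m 0 - s m 0.
    by rewrite mulmxBr Bu mxE [X in _ + X]mxE.
  by have := s_ge0 m; have := Bw m; lra.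
have u0 : u = 0.
  have [|[l]] := le1.
    by move/(congr1 (fun z => z - w)); rewrite subrr addrAC subrr add0r.
  rewrite mxE => lt_l eq_l.
  have : w l 0 <= (w - u) l 0.
    by apply: lex_le_coord le2 _ => m /eq_l; rewrite !mxE; lra.
  by rewrite !mxE lerDl oppr_ge0; move: lt_l; rewrite ltrDl => /lt_geF ->.
by have := Bu; rewrite u0 mulmx0 /s => /eqP; rewrite eq_sym subr_eq0 => /eqP.
Qed.

(** These are the coordinates of a point along the edges of the cone, measured from its apex; see
    [ray_decomposition]. *)
Definition slack B w m : R := (B.2 - B.1 *m w) m 0.

Lemma slackE B w m : slack B w m = B.2 m 0 - (B.1 *m w) m 0.
Proof. by rewrite /slack mxE [X in _ + X]mxE. Qed.

Lemma ray_decomposition B w v l : B.1 \in unitmx -> B.1 *m w = B.2 ->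
  v l 0 - w l 0 = \sum_m ray_entry B l m * slack B v m.
Proof.
move=> unitB Bw.
transitivity ((- invmx B.1 *m (B.2 - B.1 *m v)) l 0); last by rewrite mxE.
by rewrite mulNmx -Bw -mulmxBr mulmxA mulVmx // mul1mx !mxE opprB.
Qed.

(** A unit step from the apex along edge [m] stays in the cone, so minimality of [w] makes the edge
    lexicographically nonnegative. *)
Lemma lexmin_ray_ge0 B w l m : B.1 \in unitmx -> lexmin_of B w ->
  (forall k : 'I_D, (k < l)%N -> ray_entry B k m = 0) -> 0 <= ray_entry B l m.
Proof.
move=> unitB minw r0; have Bw := lexmin_vertex unitB minw.
have /(lex_le_coord (l := l)) : lex_le w (w - col m (invmx B.1)).
  apply: minw.2; apply/basis_rowsP => i.
  rewrite mulmxBr Bw colE mulmxA mulmxV // mul1mx !mxE lerBlDr lerDl; exact: ler0n.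
rewrite !mxE /ray_entry mxE -subr_ge0.
have -> : w l 0 - invmx B.1 l m - w l 0 = - invmx B.1 l m by ring.
by apply=> k /r0; rewrite /ray_entry !mxE => ->; rewrite addr0.
Qed.

(** In edge coordinates the cut asks for total weighted slack at least 1; when the basis is tight at
    [w], all slacks of [w] vanish and [w] is cut off. *)
Lemma mig_cutE w B l v :
  (dotv (mig_cut w B l).1 v <= (mig_cut w B l).2) =
  (1 <= \sum_m mig_coef w B l m * slack B v m).
Proof.
rewrite /mig_cut /= /dotv trmxK -mulmxA.
set L := \col_m mig_coef w B l m.
have -> : \sum_m mig_coef w B l m * slack B v m =
    (L^T *m B.2) 0 0 - (L^T *m (B.1 *m v)) 0 0.
  transitivity ((L^T *m (B.2 - B.1 *m v)) 0 0).
    by rewrite mxE; apply: eq_bigr => m _; rewrite [L^T 0 m]mxE [L m 0]mxE.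
  by rewrite mulmxBr mxE [X in _ + X]mxE.
by apply/idP/idP; lra.
Qed.

Lemma floor_gap w l : w l 0 \isn't a Num.int ->
  0 < w l 0 - (Num.floor (w l 0))%:~R < 1.
Proof.
move=> nint; have /andP[le_fl lt_fl] := floor_itv (w l 0).
rewrite intrD in lt_fl.
have : (Num.floor (w l 0))%:~R != w l 0 by rewrite -intrEfloor.
by rewrite neq_lt => /orP[|]; move=> ?; apply/andP; split; lra.
Qed.

(** An integral coordinate lies on one side of the split. Scale the cut by the distance from [w l 0]
    to that side: each coefficient then dominates the ray entry, signed towards that side, with
    equality for rays heading there. Summing against the slacks gives at least that distance. *)
Lemma mig_cut_valid w B l v : B.1 \in unitmx -> B.1 *m w = B.2 ->
  w l 0 \isn't a Num.int -> polyhedron (basis_rows B) v -> v l 0 \is a Num.int ->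
  dotv (mig_cut w B l).1 v <= (mig_cut w B l).2.
Proof.
move=> unitB Bw nint /basis_rowsP Bv intv.
have s_ge0 m : 0 <= slack B v m by rewrite slackE subr_ge0.
have rayE := ray_decomposition v l unitB Bw.
have /andP[gap0 gap1] := floor_gap nint.
rewrite mig_cutE; set fl : R := (Num.floor (w l 0))%:~R in gap0 gap1.
have [ge_v|lt_v] := leP (fl + 1) (v l 0).
  have p_gt0 : 0 < fl + 1 - w l 0 by lra.
  rewrite -(ler_pM2r p_gt0) mul1r.
  apply: (@le_trans _ _ (v l 0 - w l 0)); first lra.
  rewrite rayE mulr_suml; apply: ler_sum => m _.
  rewrite mulrAC; apply: ler_wpM2r => //.
  rewrite /mig_coef -/fl; have [r_gt0|r_lt0|->] := ltrgt0P; last by rewrite mul0r.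
    by rewrite invf_div divfK // gt_eqF.
  apply: (le_trans (ltW r_lt0)); apply: mulr_ge0; last exact: ltW.
  by rewrite invr_ge0 -mulrNN -invrN; apply: divr_ge0; lra.
have le_v : v l 0 <= fl.
  move: lt_v; rewrite -(floorK intv) /fl -[1]/(1%:~R) -intrD ltr_int ler_int; lia.
have p_gt0 : 0 < w l 0 - fl by lra.
rewrite -(ler_pM2r p_gt0) mul1r.
apply: (@le_trans _ _ (- (v l 0 - w l 0))); first lra.
rewrite rayE mulr_suml -sumrN; apply: ler_sum => m _.
rewrite mulrAC -mulNr; apply: ler_wpM2r => //.
rewrite /mig_coef -/fl; have [r_gt0|r_lt0|->] := ltrgt0P.
- apply: (@le_trans _ _ 0); first lra.
  by apply: mulr_ge0; [rewrite invr_ge0; apply: divr_ge0; lra|lra].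
- rewrite invf_div -[w l 0 - fl]opprB mulrN divfK // lt_eqF //; lra.
- by rewrite oppr0 mul0r.
Qed.

(** If [v] keeps the coordinates before [l], every ray with positive weight has a nonnegative entry
    at [l]. On such rays the coefficient is the entry divided by [fl + 1 - w l 0], so the cut says
    exactly that coordinate [l] reaches [fl + 1]. *)
Lemma mig_cut_progress w B l v : B.1 \in unitmx -> lexmin_of B w ->
  w l 0 \isn't a Num.int -> polyhedron (basis_rows B) v ->
  dotv (mig_cut w B l).1 v <= (mig_cut w B l).2 ->
  (forall k : 'I_D, (k < l)%N -> v k 0 = w k 0) ->
  (Num.floor (w l 0))%:~R + 1 <= v l 0.
Proof.
move=> unitB minw nint /basis_rowsP Bv; rewrite mig_cutE => cut eq_vw.
have s_ge0 m : 0 <= slack B v m by rewrite slackE subr_ge0.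
have rayE k := ray_decomposition v k unitB (lexmin_vertex unitB minw).
have /andP[gap0 gap1] := floor_gap nint.
(* Rays with positive weight vanish before l, by lexicographic positivity. *)
have ray0 k : (k <= l)%N -> forall m, 0 < slack B v m ->
    forall j : 'I_D, (j < k)%N -> ray_entry B j m = 0.
  elim: k => [//|k IHk] lt_kl m sm j.
  rewrite ltnS leq_eqVlt => /orP[/eqP jk|]; last exact: IHk (ltnW lt_kl) m sm j.
  have terms_ge0 i : 0 <= ray_entry B j i * slack B v i.
    have := s_ge0 i; rewrite le_eqVlt => /orP[/eqP<-|si]; first by rewrite mulr0.
    apply: mulr_ge0 => //; apply: lexmin_ray_ge0 minw _ => // i' lt_i'.
    by apply: IHk si _ _; rewrite ?(ltnW lt_kl) // -jk.
  have := rayE j; rewrite eq_vw ?jk // subrr => /esym/eqP.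
  rewrite psumr_eq0 // => /allP/(_ m); rewrite mem_index_enum => /(_ isT) /=.
  by rewrite mulf_eq0 (gt_eqF sm) orbF => /eqP.
set fl : R := (Num.floor (w l 0))%:~R in gap0 gap1 *.
have p_gt0 : 0 < fl + 1 - w l 0 by lra.
suff eq_sum : v l 0 - w l 0 =
    (fl + 1 - w l 0) * \sum_m mig_coef w B l m * slack B v m.
  move: cut; rewrite -(ler_pM2l p_gt0) -eq_sum mulr1; lra.
rewrite rayE mulr_sumr; apply: eq_bigr => m _.
have := s_ge0 m; rewrite le_eqVlt => /orP[/eqP<-|sm]; first by rewrite !mulr0.
have r_ge0 : 0 <= ray_entry B l m.
  by apply: lexmin_ray_ge0 minw _ => // j; apply: ray0.
rewrite mulrA; congr (_ * _); rewrite /mig_coef -/fl ltNge r_ge0 /=.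
have [r_gt0|] := ltP 0 (ray_entry B l m).
  by rewrite invf_div mulrC divfK // gt_eqF.
by move=> r_le0; rewrite mulr0; apply/eqP; rewrite eq_le r_le0.
Qed.

End BasisCones.

(** * Existence of lexicographic minima over mixed-integer polyhedra *)

Section LexminExistence.
Context {R : realType} {D : nat}.

Lemma closed_int : closed [set x : R | x \is a Num.int].
Proof.
rewrite -openC openE => x /= nint.
have x_in : x \in `](Num.floor x)%:~R, ((Num.floor x)%:~R + 1)[.
  (* [floor_gap] speaks of a vector coordinate, so the real [x] is passed as a vector of dimension
     1. *)
  have := floor_gap (w := const_mx x) (l := ord0 : 'I_1).
  rewrite !mxE => /(_ _)/andP[]; first exact/negP.
  by rewrite in_itv /= => ? ?; apply/andP; split; lra.
apply: filterS (near_in_itvoo x_in) => y; rewrite in_itv /= => /andP[lt1 lt2] inty.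
move: lt1 lt2; rewrite -(floorK inty) -[1]/(1%:~R) -intrD !ltr_int; lia.
Qed.

Lemma closed_coord_preimage (A : set R) (k : 'I_D) :
  closed A -> closed [set v : 'rV[R]_D | A (v 0 k)].
Proof.
move=> cA; apply: (@preimage_closed _ _ (fun v : 'rV[R]_D => v 0 k) A) => //.
by move=> v _; apply: coord_continuous.
Qed.

Lemma continuous_dotv_tr (u : 'cV[R]_D) :
  continuous (fun v : 'rV[R]_D => dotv u v^T).
Proof.
have -> : (fun v : 'rV[R]_D => dotv u v^T) =
    (fun v => \sum_(k <- index_enum 'I_D) u k 0 * v 0 k).
  by apply/funext => v; rewrite dotvE; apply: eq_bigr => k _; rewrite mxE.
have cont_term k : continuous (fun v : 'rV[R]_D => u k 0 * v 0 k).
  move=> v; have := @coord_continuous R 1 D 0 k v.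
  by move/(cvgMl_tmp (a := u k 0)).
elim: (index_enum 'I_D) => [|k r IHr].
  under eq_fun do rewrite big_nil.
  exact: cst_continuous.
under eq_fun do rewrite big_cons.
by move=> v; exact: continuousD (cont_term k v) (IHr v).
Qed.

Lemma closed_polyhedron (H : seq (@halfspace R D)) :
  closed [set v : 'rV[R]_D | polyhedron H v^T].
Proof.
have -> : [set v : 'rV[R]_D | polyhedron H v^T] =
    \bigcap_(h in [set h | h \in H]) [set v : 'rV[R]_D | dotv h.1 v^T <= h.2].
  by apply/seteqP; split.
apply: closed_bigI => h _.
apply: (@preimage_closed _ _ (fun v : 'rV[R]_D => dotv h.1 v^T) [set y | y <= h.2]).
  by move=> v _; exact: continuous_dotv_tr.
exact: closed_le.
Qed.

(** A closed subset of a box is compact. An empty [J] serves the LPs of the algorithm, a nonempty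
    one the existence of a MILP optimum. *)
Lemma mixed_integer_lexmin (H : seq (@halfspace R D)) (J : pred 'I_D) (M : R)
    (K := [set w : 'cV[R]_D | polyhedron H w /\
             forall k, J k -> w k 0 \is a Num.int]) :
  K !=set0 -> (forall w, K w -> forall k, - M <= w k 0 <= M) ->
  exists2 w, K w & forall v, K v -> lex_le w v.
Proof.
move=> K0 K_le; apply: compact_lexmin => //.
(* Compactness of a product of segments is used in its row-vector form [rV_compact], hence the
   transposes. *)
apply: (@subclosed_compact _ _ [set v : 'rV[R]_D | forall k, [set` `[- M, M]] (v 0 k)]).
- have -> : [set v : 'rV[R]_D | K v^T] = [set v : 'rV[R]_D | polyhedron H v^T] `&`
      \bigcap_(k in [set k | J k]) [set v : 'rV[R]_D | v 0 k \is a Num.int].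
    apply/seteqP; split=> v /= [Hv Jv]; split=> // k /Jv; by rewrite mxE.
  apply: closedI; first exact: closed_polyhedron.
  by apply: closed_bigI => k _; apply: closed_coord_preimage closed_int.
- apply: (@rV_compact R D (fun=> [set` `[- M, M]])) => _; exact: segment_compact.
- by move=> v /K_le Kv k /=; have := Kv k; rewrite mxE in_itv.
Qed.

Lemma boxP (M : R) (w : 'cV[R]_D) :
  polyhedron (box M D) w <-> forall k, - M <= w k 0 <= M.
Proof.
have dE k : dotv (delta_mx k 0) w = w k 0.
  by rewrite /dotv trmx_delta -rowE mxE.
have dNE k : dotv (- delta_mx k 0) w = - w k 0.
  by rewrite -dE /dotv linearN mulNmx mxE.
rewrite /box polyhedron_cat; split=> [[Hw1 Hw2] k|Hw].
  have := Hw1 (delta_mx k 0, M).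
  rewrite (map_f (fun k => (delta_mx k 0, M))) ?mem_enum //= dE => /(_ isT).
  have := Hw2 (- delta_mx k 0, M).
  rewrite (map_f (fun k => (- delta_mx k 0, M))) ?mem_enum //= dNE => /(_ isT).
  lra.
by split=> h /mapP[k _ ->] /=; rewrite ?dNE ?dE; have := Hw k; lra.
Qed.

End LexminExistence.

(** * LPs whose cost is the first coordinate *)

Section Run.
Context {R : realType} {dZ dR : nat}.
Local Notation d := (dZ + dR)%N.
Local Notation e1 := (e1 dZ dR).
Implicit Types (w v : 'cV[R]_(1 + d)) (X : set 'cV[R]_(1 + d)).

Lemma rho_ofE w : rho_of w = w (lshift d 0) 0.
Proof. by rewrite /rho_of mxE. Qed.

Lemma dotv_e1 w : dotv e1 w = rho_of w.
Proof.
rewrite /dotv /e1 tr_col_mx -{1}(vsubmxK w) mul_row_col trmx0 mul0mx addr0.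
by rewrite trmx1 mul1mx.
Qed.

Lemma dotv_col_mx (r : 'cV[R]_1) (f : 'cV[R]_d) w :
  dotv (col_mx r f) w = r 0 0 * rho_of w + dotv f (z_of w).
Proof.
rewrite /dotv tr_col_mx -{1}(vsubmxK w) mul_row_col mxE; congr (_ + _).
by rewrite mxE big_ord1 mxE.
Qed.

Lemma lex_le_rho w v : lex_le w v -> rho_of w <= rho_of v.
Proof. by rewrite !rho_ofE => /lex_le_coord; apply. Qed.

(** A point of larger cost is already larger at the leading coordinate, and a point of equal cost is
    itself optimal, so the tie-break compares it. *)
Lemma is_lexopt_e1 X w :
  is_lexopt X e1 w <-> X w /\ forall v, X v -> lex_le w v.
Proof.
split=> [[[Xw optw] lexw]|[Xw minw]]; split=> //.
- move=> v Xv; have [->|/eqP nvw] := eqVneq v w; first by left.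
  have := optw v Xv; rewrite !dotv_e1 le_eqVlt => /orP[/eqP eq_rho|lt_rho].
    right; apply: lexw => //; split=> // u Xu.
    by rewrite dotv_e1 -eq_rho -!dotv_e1; apply: optw.
  by right; exists (lshift d 0); rewrite -?rho_ofE //.
- by split=> // v Xv; rewrite !dotv_e1; apply/lex_le_rho/minw.
- by move=> v [Xv _] nvw; case: (minw v Xv) => // ?; case: nvw.
Qed.

(** [LPlexsolv] promises something only when a lex-optimal solution exists; the box and one feasible
    point provide it. *)
Lemma LPlexsolv_e1 (H : seq (@halfspace R (1 + d))) (M : R) out :
  {subset box M (1 + d) <= H} -> polyhedron H !=set0 ->
  LPlexsolv H e1 out ->
  [/\ polyhedron H out.1, {subset basis_rows out.2 <= H}, out.2.1 \in unitmx &
      lexmin_of out.2 out.1].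
Proof.
move=> boxH [w0 Hw0] solv.
have [||v [Hv _] minv] := @mixed_integer_lexmin R (1 + d) H pred0 M.
- by exists w0; split.
- by move=> w [Hw _]; apply/boxP; apply: polyhedron_subset Hw.
have optv : is_lexopt (polyhedron H) e1 v.
  by apply/is_lexopt_e1; split=> // u Hu; apply: minv.
have [-> [sBH /is_lexopt_e1[Bv minBv] _ unitB]] := solv v optv.
by split.
Qed.

End Run.

Lemma MIGoracleP {R : realType} D DZ (w : 'cV[R]_D) (B : @lp_basis R D) h :
  h \in MIGoracle DZ w B -> exists l : 'I_D,
    [/\ (l < DZ)%N, w l 0 \isn't a Num.int & h = mig_cut w B l].
Proof.
rewrite /MIGoracle; case: pickP => [l /and3P[lDZ nint _]|_ //].
by rewrite mem_seq1 => /eqP ->; exists l.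
Qed.

(** The predicate given to [pick] has at most one solution, so the choice is forced. *)
Lemma MIGoracle_first {R : realType} D DZ (w : 'cV[R]_D) (B : @lp_basis R D)
    (l : 'I_D) :
  (l < DZ)%N -> w l 0 \isn't a Num.int ->
  (forall k : 'I_D, (k < l)%N -> w k 0 \is a Num.int) ->
  mig_cut w B l \in MIGoracle DZ w B.
Proof.
move=> lDZ nint intk; rewrite /MIGoracle; case: pickP => [l'|/(_ l)].
  move=> /and3P[_ nint' /forallP intk'].
  have -> : l' = l; last exact: mem_head.
  apply: val_inj; have [lt|lt|//] := ltngtP l' l.
    by rewrite intk in nint'.
  by have := intk' l; rewrite lt /= (negPf nint).
rewrite lDZ nint /=; case/negP; apply/forallP => k.
by apply/implyP => /intk.
Qed.

Lemma MIGoracle_int {R : realType} D DZ (w : 'cV[R]_D) (B : @lp_basis R D) :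
  (forall l : 'I_D, (l < DZ)%N -> w l 0 \is a Num.int) ->
  MIGoracle DZ w B = [::].
Proof.
move=> intw; case E: (MIGoracle DZ w B) => [//|h s].
have [|l [lDZ nint _]] := @MIGoracleP R D DZ w B h; first by rewrite E mem_head.
by rewrite intw in nint.
Qed.

(** * Vertices of a finite arrangement *)

Section FiniteVertices.
Context {R : realType} {D : nat}.

(** Selections with repetition or with a singular matrix give meaningless points, which is harmless:
    only the finiteness of the index type matters. *)
Definition vertex_of (S : seq (@halfspace R D)) (f : {ffun 'I_D -> 'I_(size S)})
    : 'cV[R]_D :=
  invmx (\matrix_(m, j) (nth (0, 0) S (f m)).1 j 0)
  *m \col_m (nth (0, 0) S (f m)).2.

Lemma vertex_ofP (S : seq (@halfspace R D)) (B : @lp_basis R D) w :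
  {subset basis_rows B <= S} -> B.1 \in unitmx -> B.1 *m w = B.2 ->
  exists f, w = vertex_of (S := S) f.
Proof.
move=> sBS unitB Bw.
have row_in m : ((row m B.1)^T, B.2 m 0) \in S.
  by apply: sBS; apply/mapP; exists m; rewrite ?mem_enum.
have idx (m : 'I_D) (h := ((row m B.1)^T, B.2 m 0)) : (index h S < size S)%N.
  by rewrite index_mem row_in.
exists [ffun m => Ordinal (idx m)]; rewrite /vertex_of.
have -> : \col_m (nth (0, 0) S ([ffun m => Ordinal (idx m)] m)).2 = B.2.
  by apply/matrixP => m j; rewrite ord1 mxE ffunE /= nth_index.
have -> : \matrix_(m, j) (nth (0, 0) S ([ffun m => Ordinal (idx m)] m)).1 j 0 = B.1.
  by apply/matrixP => m j; rewrite mxE ffunE /= nth_index // !mxE.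
by rewrite -Bw mulmxA mulVmx // mul1mx.
Qed.

End FiniteVertices.

(** * The mixed-integer feasible set and the MILP optimum *)

Section MixedFeasible.
Context {R : realType} {n dZ dR : nat}.
Local Notation d := (dZ + dR)%N.
Context (a : 'I_n -> 'cV[R]_d) (b : 'I_n -> R) (c : 'cV[R]_d) (eps M : R).
Implicit Types w : 'cV[R]_(1 + d).

Lemma agent_constraintsP i w :
  polyhedron (agent_constraints a b c eps M i) w <->
  [/\ dotv (a i) (z_of w) <= b i, dotv c (z_of w) <= eps * rho_of w &
      forall k, - M <= w k 0 <= M].
Proof.
have E1 : dotv (col_mx 0 (a i)) w = dotv (a i) (z_of w).
  by rewrite dotv_col_mx mxE mul0r add0r.
have E2 : dotv (col_mx (- eps)%:M c) w = - eps * rho_of w + dotv c (z_of w).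
  by rewrite dotv_col_mx mxE.
rewrite /agent_constraints polyhedron_cat -cat1s polyhedron_cat.
rewrite 2!polyhedron_seq1 /= E1 E2; split.
  by move=> [[? ?] /boxP ?]; split=> //; lra.
by move=> [? ? ?]; split; [split=> //=; lra | apply/boxP].
Qed.

Lemma int_coordsP w :
  (forall l : 'I_(1 + d), (l < 1 + dZ)%N -> w l 0 \is a Num.int) <->
  rho_of w \is a Num.int /\
  forall k : 'I_dZ, z_of w (lshift dR k) 0 \is a Num.int.
Proof.
rewrite rho_ofE; split=> [intw|[int0 intz] l].
  by split=> [|k]; rewrite ?mxE; apply: intw => //=; rewrite ltn_add2l.
have [j ->|j ->] := split_ordP l; first by rewrite ord1.
rewrite /= ltn_add2l => lt_j; have := intz (Ordinal lt_j); rewrite mxE.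
by congr (w _ 0 \is a Num.int); apply: val_inj.
Qed.

Definition mixed_feasible : set 'cV[R]_(1 + d) :=
  [set w : 'cV[R]_(1 + d) |
     (forall l : 'I_(1 + d), (l < 1 + dZ)%N -> w l 0 \is a Num.int) /\
     forall i, polyhedron (agent_constraints a b c eps M i) w].

(** Rounding up gives the least integer [rho] allowed by [c^T z <= eps rho]; the lower bound on [M]
    keeps it in the box. *)
Lemma mixed_feasible_of_PI (cmin cmax : R) (z : 'cV[R]_d) :
  0 < eps ->
  milp_P a b `<=` [set z | forall l, - M <= z l 0 <= M] ->
  is_min [set dotv c z | z in milp_P a b] cmin ->
  is_max [set dotv c z | z in milp_P a b] cmax ->
  Num.max (- cmin / eps) (Num.ceil (cmax / eps))%:~R <= M ->
  milp_PI a b z ->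
  mixed_feasible (col_mx (Num.ceil (dotv c z / eps))%:~R%:M z).
Proof.
move=> eps_gt0 P_sub [_ cminP] [_ cmaxP]; rewrite ge_max => /andP[min_le max_le].
move=> [Pz intz]; set r := Num.ceil _; set w := col_mx _ _.
have rhoE : rho_of w = r%:~R by rewrite /rho_of col_mxKu mxE.
have zE : z_of w = z by rewrite /z_of col_mxKd.
have img : [set dotv c z | z in milp_P a b] (dotv c z) by exists z.
have r_ge : dotv c z / eps <= r%:~R by apply: ceil_ge.
have r_le : (r%:~R : R) <= M.
  apply: le_trans max_le; rewrite ler_int; apply: le_ceil.
  by rewrite ler_pM2r ?invr_gt0 //; apply: cmaxP.
have r_geN : - M <= r%:~R.
  apply: le_trans r_ge; rewrite lerNl -mulNr; apply: le_trans min_le.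
  by rewrite ler_pM2r ?invr_gt0 // lerN2; apply: cminP.
split; first by apply/int_coordsP; rewrite rhoE zE intr_int.
move=> i; apply/agent_constraintsP; rewrite rhoE zE; split=> //.
  by rewrite mulrC -ler_pdivrMr.
move=> k; have [j ->|j ->] := split_ordP k.
  by rewrite ord1 -rho_ofE rhoE r_geN.
by rewrite col_mxEd; apply: P_sub.
Qed.

(* The optimum is the lexicographic minimum of { (c^T z, z) | z in P_I }. *)
Lemma milp_opt_exists (cmin cmax : R) :
  milp_PI a b !=set0 ->
  milp_P a b `<=` [set z | forall l, - M <= z l 0 <= M] ->
  is_min [set dotv c z | z in milp_P a b] cmin ->
  is_max [set dotv c z | z in milp_P a b] cmax ->
  exists zs, is_opt (milp_PI a b) c zs.
Proof.
move=> [z0 PIz0] P_sub [_ cminP] [_ cmaxP].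
pose H : seq (@halfspace R (1 + d)) :=
  [seq (col_mx 0 (a i), b i) | i : 'I_n] ++
  ([:: (col_mx (-1)%:M c, 0)] ++ [:: (col_mx 1%:M (- c), 0)]).
(* Coordinate 0 carries the exact cost here and need not be an integer, unlike in
   [mixed_feasible]. *)
pose J : pred 'I_(1 + d) := fun l => (0 < l < 1 + dZ)%N.
have HP w : polyhedron H w /\ (forall l, J l -> w l 0 \is a Num.int) <->
    milp_PI a b (z_of w) /\ rho_of w = dotv c (z_of w).
  have E1 i : dotv (col_mx 0 (a i)) w = dotv (a i) (z_of w).
    by rewrite dotv_col_mx mxE mul0r add0r.
  have E2 : dotv (col_mx (-1)%:M c) w = - rho_of w + dotv c (z_of w).
    by rewrite dotv_col_mx mxE mulN1r.
  have E3 : dotv (col_mx 1%:M (- c)) w = rho_of w - dotv c (z_of w).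
    by rewrite dotv_col_mx mxE mul1r [dotv (- c) _]/dotv linearN mulNmx [X in _ + X]mxE.
  rewrite /H 2!polyhedron_cat 2!polyhedron_seq1 /= E2 E3.
  split=> [[[Ha /= [le1 le2]] intw]|[[Pz intz] eq_rho]].
    split; last by apply/eqP; rewrite eq_le; apply/andP; split; lra.
    split=> [i|k].
      rewrite -E1; apply: (Ha (col_mx 0 (a i), b i)).
      by apply/mapP; exists i; rewrite ?mem_enum.
    by rewrite mxE; apply: intw; rewrite /J /= ltn_add2l.
  split.
    split; last by split=> /=; lra.
    by move=> h /mapP[i _ ->] /=; rewrite E1.
  move=> l /andP[]; have [j ->|j ->] := split_ordP l; first by rewrite ord1.
  rewrite /= ltn_add2l => _ lt_j; have := intz (Ordinal lt_j); rewrite mxE.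
  by congr (w _ 0 \is a Num.int); apply: val_inj.
pose lift z : 'cV[R]_(1 + d) := col_mx (dotv c z)%:M z.
have liftP z : rho_of (lift z) = dotv c z /\ z_of (lift z) = z.
  by rewrite /rho_of /z_of col_mxKu col_mxKd mxE.
pose M' := Num.max M (Num.max (- cmin) cmax).
have [||w Kw minw] := @mixed_integer_lexmin R (1 + d) H J M'.
- by exists (lift z0); apply/HP; have [-> ->] := liftP z0.
- move=> w /HP[[Pz intz] eq_rho] k.
  have [leM [leN lex]] : M <= M' /\ - cmin <= M' /\ cmax <= M'.
    by rewrite /M' !le_max !lexx !orbT.
  have img : [set dotv c z | z in milp_P a b] (dotv c (z_of w)) by exists (z_of w).
  have [j ->|j ->] := split_ordP k.
    rewrite ord1 -rho_ofE eq_rho; have := cminP _ img; have := cmaxP _ img.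
    by move=> ? ?; apply/andP; split; lra.
  have := P_sub _ Pz j; rewrite mxE => /andP[? ?]; apply/andP; split; lra.
- have [PIz eq_rho] := (HP w).1 Kw; exists (z_of w); split=> // v PIv.
  have [rhov zv] := liftP v; rewrite -eq_rho -rhov; apply: lex_le_rho.
  by apply: minw; apply/HP; rewrite rhov zv.
Qed.

(** The empty set is convex, so it is its own hull. *)
Lemma convex_hull_neq0 D (A : set 'cV[R]_D) : convex_hull A !=set0 -> A !=set0.
Proof.
move=> [w hullw]; apply/set0P/negP => /eqP A0.
have := @smallest_sub _ (@convex_set R 'cV[R]_D) A set0.
rewrite A0 => /(_ _ (@subset_refl _ _)) sub.
move: hullw; rewrite /convex_hull A0 => /sub; apply.
by move=> u v l; rewrite inE.
Qed.

End MixedFeasible.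

(** * Invariants, stabilisation and consensus of a run *)

Section DicutRun.
Context {R : realType} {n dZ dR : nat}.
Local Notation d := (dZ + dR)%N.
Local Notation DZ := (1 + dZ)%N.
Context (a : 'I_n -> 'cV[R]_d) (b : 'I_n -> R) (c : 'cV[R]_d) (eps M : R).
Context (E : nat -> rel 'I_n) (x : 'I_n -> nat -> @state R dZ dR).
Local Notation feasible := (mixed_feasible a b c eps M).
Local Notation constraints := (agent_constraints a b c eps M).
Local Notation Htmp := (Htmp a b c eps M E x).

(** Quantified over all agents at once, because [Htmp] mixes the bases of the neighbors. *)
Definition run_invariant t := forall i,
  [/\ polyhedron (constraints i) (x i t).1, (x i t).2.1 \in unitmx,
      lexmin_of (x i t).2 (x i t).1 &
      feasible `<=` polyhedron (basis_rows (x i t).2)].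

Lemma box_sub_constraints i :
  {subset box M (1 + d) <= constraints i}.
Proof. by move=> h hbox; rewrite /agent_constraints mem_cat hbox orbT. Qed.

Lemma constraints_sub_Htmp i t : {subset constraints i <= Htmp i t}.
Proof. by move=> h hi; rewrite /Defs.Htmp 3!mem_cat hi !orbT. Qed.

Lemma basis_sub_Htmp i t : {subset basis_rows (x i t).2 <= Htmp i t}.
Proof. by move=> h hi; rewrite /Defs.Htmp !mem_cat hi !orbT. Qed.

Lemma mig_sub_Htmp i t :
  {subset MIGoracle DZ (x i t).1 (x i t).2 <= Htmp i t}.
Proof. by move=> h hi; rewrite /Defs.Htmp !mem_cat hi !orbT. Qed.

Lemma neighbor_sub_Htmp i j t :
  E t j i -> {subset basis_rows (x j t).2 <= Htmp i t}.
Proof.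
move=> Eji h hj; rewrite /Defs.Htmp mem_cat; apply/orP; left.
apply/flattenP; exists (basis_rows (x j t).2) => //.
by apply/mapP; exists j; rewrite ?mem_enum ?finset.inE.
Qed.

Lemma Htmp_cases i t h : h \in Htmp i t ->
  [\/ exists j, h \in basis_rows (x j t).2, h \in constraints i,
      h \in MIGoracle DZ (x i t).1 (x i t).2 | h = cost_cut (x i t).1].
Proof.
rewrite /Defs.Htmp mem_cat => /orP[/flattenP[s /mapP[j _ ->] hj]|].
  by constructor 1; exists j.
rewrite mem_cat => /orP[hi|]; first by constructor 1; exists i.
rewrite mem_cat => /orP[hi|]; first by constructor 2.
rewrite mem_cat mem_seq1 => /orP[hi|/eqP ->]; first by constructor 3.
by constructor 4.
Qed.

(** Bases are covered by the invariant and the MIG cut by [mig_cut_valid]. For the cost cut, the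
    integer [rho] of a feasible point is at least that of the iterate, hence at least its
    ceiling. *)
Lemma feasible_sub_Htmp i t :
  run_invariant t -> feasible `<=` polyhedron (Htmp i t).
Proof.
move=> inv v feas_v h /Htmp_cases[[j]|||->].
- by have [_ _ _ /(_ v feas_v)] := inv j; apply.
- exact: feas_v.2.
- have [_ unitB minw /(_ v feas_v) Bv] := inv i.
  move=> /MIGoracleP[l [lDZ nint ->]].
  by apply: mig_cut_valid => //; [apply: lexmin_vertex|apply: feas_v.1].
- have [_ _ [_ minw] /(_ v feas_v)/minw/lex_le_rho le_rho] := inv i.
  have [intv _] := (int_coordsP v).1 feas_v.1.
  rewrite /cost_cut /= /dotv linearN mulNmx mxE -/(dotv _ v) dotv_e1 lerN2.
  by rewrite -(floorK intv) ler_int ceil_le_int floorK.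
Qed.

Context (feasible_neq0 : feasible !=set0).
Context (x_run : dicut_run a b c eps M E x).

Lemma run_step i t : run_invariant t ->
  [/\ polyhedron (Htmp i t) (x i t.+1).1,
      {subset basis_rows (x i t.+1).2 <= Htmp i t}, (x i t.+1).2.1 \in unitmx &
      lexmin_of (x i t.+1).2 (x i t.+1).1].
Proof.
move=> inv; apply: (LPlexsolv_e1 (M := M)) (x_run.2 i t).
  by move=> h hbox; apply: constraints_sub_Htmp; apply: box_sub_constraints.
by have [v feas_v] := feasible_neq0; exists v; apply: feasible_sub_Htmp.
Qed.

Lemma run_invariantP t : run_invariant t.
Proof.
elim: t => [|t IHt] i.
  have [||Hw sB unitB minw] := LPlexsolv_e1 (M := M) _ _ (x_run.1 i).
  - exact: box_sub_constraints.
  - by have [v feas_v] := feasible_neq0; exists v; apply: feas_v.2.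
  by split=> // v feas_v; apply: polyhedron_subset sB _ (feas_v.2 i).
have [Hw sB unitB minw] := run_step i IHt; split=> //.
  exact: polyhedron_subset (@constraints_sub_Htmp i t) _ Hw.
move=> v feas_v; apply: polyhedron_subset sB _ _.
exact: feasible_sub_Htmp.
Qed.

(** The new iterate lies in the old basis cone, whose lexicographic minimum is the old iterate.
    [run_edge] applies the same argument to the basis of the sender. *)
Lemma run_nondecreasing i t : lex_le (x i t).1 (x i t.+1).1.
Proof.
have [_ _ [_ minw] _] := run_invariantP t i; apply: minw.
have [Hw _ _ _] := run_step i (run_invariantP t).
exact: polyhedron_subset (@basis_sub_Htmp i t) _ Hw.
Qed.

Lemma run_edge i j t : E t j i -> lex_le (x j t).1 (x i t.+1).1.
Proof.
move=> Eji; have [_ _ [_ minw] _] := run_invariantP t j; apply: minw.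
have [Hw _ _ _] := run_step i (run_invariantP t).
exact: polyhedron_subset (neighbor_sub_Htmp Eji) _ Hw.
Qed.

Lemma run_floor_jump i t (l : 'I_(1 + d)) : (l < DZ)%N ->
  (x i t).1 l 0 \isn't a Num.int ->
  (forall k : 'I_(1 + d), (k < l)%N ->
     (x i t).1 k 0 \is a Num.int /\ (x i t.+1).1 k 0 = (x i t).1 k 0) ->
  (Num.floor ((x i t).1 l 0))%:~R + 1 <= (x i t.+1).1 l 0.
Proof.
move=> lDZ nint eqk.
have [_ unitB minw _] := run_invariantP t i.
have [Hw _ _ _] := run_step i (run_invariantP t).
apply: (mig_cut_progress unitB minw nint).
- exact: polyhedron_subset (@basis_sub_Htmp i t) _ Hw.
- apply: Hw; apply: mig_sub_Htmp; apply: MIGoracle_first => // k /eqk[//].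
- by move=> k /eqk[].
Qed.

Lemma run_integers_stable : exists T, forall i t, (T <= t)%N ->
  forall l : 'I_(1 + d), (l < DZ)%N ->
    (x i t.+1).1 l 0 = (x i t).1 l 0 /\ (x i t).1 l 0 \is a Num.int.
Proof.
apply: finType_common_bound => i.
have [|||T HT] := @integer_coords_stable R (1 + d) (fun t => (x i t).1) M DZ.
- exact: run_nondecreasing.
- move=> t l; have [/agent_constraintsP[_ _ box_w] _ _ _] := run_invariantP t i.
  by have /andP[] := box_w l.
- by move=> t l; apply: run_floor_jump.
exists T => t leTt l lDZ; have [eq1 intl] := HT t leTt l lDZ.
by have [-> _] := HT t.+1 (leqW leTt) l lDZ.
Qed.

(* Once the integer coordinates are frozen no new half-space is ever created,
   so the iterates are vertices of a fixed finite arrangement. *)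
Lemma run_stable : exists T,
  (forall i t, (T <= t)%N -> (x i t).1 = (x i T).1) /\
  (forall i (l : 'I_(1 + d)), (l < DZ)%N -> (x i T).1 l 0 \is a Num.int).
Proof.
have [T1 HT1] := run_integers_stable.
(* Cost cuts depend on the iterate only through [rho], which is frozen from [T1] on, so those at
   [T1] suffice; MIG cuts are absent because the oracle then returns nothing. *)
pose S := flatten [seq basis_rows (x j T1).2 | j : 'I_n] ++
  (flatten [seq constraints j | j : 'I_n] ++
   [seq cost_cut (x j T1).1 | j : 'I_n]).
have rhoT i t : (T1 <= t)%N -> rho_of (x i t).1 = rho_of (x i T1).1.
  elim: t => [|t IHt]; first by rewrite leqn0 => /eqP ->.
  rewrite leq_eqVlt => /orP[/eqP->//|]; rewrite ltnS => leTt.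
  by rewrite -IHt // !rho_ofE (HT1 i t leTt (lshift d 0) _).1.
have base_in_S i : {subset basis_rows (x i T1).2 <= S}.
  move=> h hB; rewrite /S mem_cat; apply/orP; left; apply/flattenP.
  by exists (basis_rows (x i T1).2) => //; apply/mapP; exists i; rewrite ?mem_enum.
have in_S t : (T1 <= t)%N -> forall i, {subset basis_rows (x i t).2 <= S}.
  elim: t => [|t IHt].
    by rewrite leqn0 => /eqP T10 i; have := base_in_S i; rewrite T10.
  rewrite leq_eqVlt => /orP[/eqP T1t i|].
    by have := base_in_S i; rewrite T1t.
  rewrite ltnS => leTt i h hB.
  have [_ sB _ _] := run_step i (run_invariantP t).
  have [[j hj]|hc||->] := Htmp_cases (sB h hB); first exact: IHt hj.
  - rewrite /S !mem_cat; apply/orP; right; apply/orP; left.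
    apply/flattenP; exists (constraints i) => //.
    by apply/mapP; exists i; rewrite ?mem_enum.
  - by rewrite MIGoracle_int // => l lDZ; exact: (HT1 i t leTt l lDZ).2.
  - rewrite /S !mem_cat; apply/orP; right; apply/orP; right.
    apply/mapP; exists i; rewrite ?mem_enum //.
    by rewrite /cost_cut rhoT.
have [T2 HT2] : exists T, forall i t, (T <= t)%N ->
    (T1 <= t)%N /\ (x i t.+1).1 = (x i t).1.
  apply: finType_common_bound => i.
  have [||T leT HT] := @finite_range_stable R (1 + d) _ (vertex_of (S := S))
    (fun t => (x i t).1) T1.
  - move=> t leTt; have [_ unitB minw _] := run_invariantP t i.
    by apply: vertex_ofP (in_S t leTt i) unitB (lexmin_vertex unitB minw).
  - by move=> t _; apply: run_nondecreasing.
  exists T => t leTt; split; first exact: leq_trans leTt.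
  by rewrite HT ?leqW // HT.
exists T2; split=> [i|i l lDZ].
  elim=> [|t IHt]; first by rewrite leqn0 => /eqP ->.
  rewrite leq_eqVlt => /orP[/eqP->//|]; rewrite ltnS => leTt.
  by rewrite (HT2 i t leTt).2 IHt.
exact: (HT1 i T2 (HT2 i T2 (leqnn T2)).1 l lDZ).2.
Qed.

(** The edges of a path may appear at unrelated times after [T], but the values no longer change, so
    the inequalities of [run_edge] chain along it. Paths exist both ways, and antisymmetry
    concludes. *)
Lemma run_consensus (T : nat) : jointly_strongly_connected E ->
  (forall i t, (T <= t)%N -> (x i t).1 = (x i T).1) ->
  forall i j, (x i T).1 = (x j T).1.
Proof.
move=> E_jsc stable.
have le_all i j : lex_le (x i T).1 (x j T).1.
  have /connectP[p] := E_jsc T i j.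
  elim: p i => [i _ ->|k p IHp i /= /andP[/asboolP[tau leT Eik] path_p] jE].
    exact: lex_lexx.
  apply: lex_le_trans (IHp k path_p jE).
  by rewrite -(stable i tau leT) -(stable k tau.+1 (leqW leT)); apply: run_edge.
by move=> i j; apply: lex_le_anti.
Qed.

End DicutRun.

Theorem mainTheorem2 (R : realType) (n dZ dR : nat)
  (a : 'I_n -> 'cV[R]_(dZ + dR)) (b : 'I_n -> R) (c : 'cV[R]_(dZ + dR))
  (eps M cmin cmax : R) (E : nat -> rel 'I_n)
  (x : 'I_n -> nat -> @state R dZ dR)
  (eps_gt0 : 0 < eps)
  (P_bounded : bounded_set (milp_P a b))
  (convPI_neq0 : convex_hull (milp_PI a b) !=set0)
  (M_gt0 : 0 < M)
  (P_sub_HM : milp_P a b `<=`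
     [set z : 'cV[R]_(dZ + dR) | forall l, - M <= z l 0 <= M])
  (cminP : is_min [set dotv c z | z in milp_P a b] cmin)
  (cmaxP : is_max [set dotv c z | z in milp_P a b] cmax)
  (M_ge : Num.max (- cmin / eps) (Num.ceil (cmax / eps))%:~R <= M)
  (E_jsc : jointly_strongly_connected E)
  (x_run : dicut_run a b c eps M E x) :
  exists (T : nat) (zeps : 'cV[R]_(dZ + dR)),
    eps_suboptimal a b c eps zeps /\
    forall (i : 'I_n) (t : nat), (T <= t)%N -> z_of (x i t).1 = zeps.
Proof.
have [zs zs_opt] :=
  milp_opt_exists (convex_hull_neq0 convPI_neq0) P_sub_HM cminP cmaxP.
have feas := mixed_feasible_of_PI eps_gt0 P_sub_HM cminP cmaxP M_ge zs_opt.1.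
have feasible_neq0 : mixed_feasible a b c eps M !=set0 by eexists; exact: feas.
have [T [stable intT]] := run_stable feasible_neq0 x_run.
have consensus := run_consensus feasible_neq0 x_run E_jsc stable.
(* Without agents the convergence claim is vacuous, and [zs] itself serves as the suboptimal
   point. *)
have [i0 _|no_agent] := pickP (pred_of_simpl (predT : simpl_pred 'I_n)); last first.
  exists 0%N, zs; split=> [|i]; last by have := no_agent i.
  by split; [exact: zs_opt.1 | exists zs; rewrite // subrr ltW].
exists T, (z_of (x i0 T).1).
split; last by move=> i t leTt; rewrite stable // (consensus i i0).
have inv i := run_invariantP feasible_neq0 x_run T i.
set w := (x i0 T).1.
have [int_rho int_z] := (int_coordsP w).1 (intT i0).
split.
  split=> // i; have [/agent_constraintsP[Pz _ _] _ _ _] := inv i.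
  by rewrite /w (consensus i0 i).
exists zs => //.
have [/agent_constraintsP[_ cz _] _ [_ minw] /(_ _ feas)] := inv i0.
move=> /minw/lex_le_rho; rewrite [rho_of (col_mx _ _)]/rho_of col_mxKu mxE mulr1n.
(* Rounding up loses less than one unit of [rho], which is worth [eps] in the cost. *)
have /andP[lt_ceil _] := ceil_itv (dotv c zs / eps).
rewrite intrD in lt_ceil; move=> le_rho.
have : eps * rho_of w <= eps * (dotv c zs / eps + 1).
  by rewrite ler_pM2l //; apply: le_trans le_rho _; lra.
rewrite mulrDr mulr1 mulrC [eps * (_ / _)]mulrC divfK ?gt_eqF // mulrC.
by move: cz; rewrite -/w; lra.
Qed.
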